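(* Let $P(x)\in\mathbb{Z}[x]$ be a polynomial of degree $d$ that is reducible over $\mathbb{Q}$. Then for any two irrational real roots $\alpha,\beta$ of $P(x)$, either $|\alpha|=|\beta|$ or $$\big||\alpha|-|\beta|\big|\ge 2^{-3d^2/2+3d-1}\,d^{(-d+2)/2}\,\mathrm{H}(P)^{-d+2}.$$
   Context: The height $\mathrm{H}(P)$ of a polynomial $P$ with integer coefficients is the maximum of the absolute values of its coefficients. Reducible over $\mathbb{Q}$ means that $P$ is a product of two nonconstant polynomials in $\mathbb{Q}[x]$. *)

(* Defs.v *)
(* MathComp / MathComp-Analysis *)
From mathcomp Require Import all_boot all_order all_algebra.
From mathcomp Require Import all_classical all_reals all_analysis.

Set Implicit Arguments.
Unset Strict Implicit.
Unset Printing Implicit Defensive.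

Import Order.TTheory GRing.Theory Num.Theory.
Local Open Scope ring_scope.

Definition height (P : {poly int}) : nat := (\max_(i < size P) `|(P`_i)%R|)%N.

(* Irreducibility in polydiv.v is [irreducible_poly]; its negation would also
   count constants as reducible, hence this separate notion. *)
Definition reducible_over_Q (P : {poly int}) : Prop :=
  exists A B : {poly rat},
    [/\ (1 < size A)%N, (1 < size B)%N & map_poly intr P = A * B].

(* Main.v *)
Require Import Defs.
From mathcomp Require Import all_boot all_order all_algebra all_field.
From mathcomp Require Import all_classical all_reals all_analysis.
From mathcomp Require Import complex.
From mathcomp Require Import ring zify.
Set Implicit Arguments.
Unset Strict Implicit.
Unset Printing Implicit Defensive.
Import Order.TTheory GRing.Theory Num.Theory.
Local Open Scope ring_scope.

(** The difference of |alpha| and |beta| is, up to sign, alpha - z beta for a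
    sign z = 1 or z = -1.  As in Liouville's argument, alpha - z beta is, up to
    sign, a factor of a product over pairs of conjugates which is a nonzero
    rational integer, hence at least 1 in absolute value; the other factors
    are bounded from above by Mahler measures, and alpha - z beta cannot be too
    small.

    Let f be the minimal polynomial of alpha over Z, with leading coefficient a,
    degree m and complex roots u_i.  Because P is reducible, m <= d - 1.  There
    are three cases.
    - If z beta is a root of f, the product is a^(2m-2) times the product of the
      u_i - u_j over i != j: the discriminant ([conjugates_bound]).
    - If only beta is a root of f, then z = -1, and the u_i - u_j are replaced
      by the u_i + u_j ([sum_conjugates_bound]).
    - If neither is a root of f, let g be the minimal polynomial of beta, with
      leading coefficient b, degree n and roots v_j.  Then f g divides P, so
      m + n <= d, and the product is the resultant, a^n b^m times the product
      of all u_i - z v_j ([coprime_bound]).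
    Using the full degree d = m in the first two cases, or n = d - 1 in the
    last, would cost one more factor H(P): reducibility of P and irrationality
    of the roots, which gives m, n >= 2, are what saves it.

    All three products have the form a^k b^l times a product over the edges of a
    bipartite graph between the roots u_i and v_j, in which the u_i have degree
    at most k and the v_j degree at most l; they are treated at once in
    [edge_prod_gap].  Such a product is an algebraic integer
    ([integral_edge_prod]): expand it, and distribute the k factors a over
    the powers of the u_i, as a times any subproduct of distinct roots of f is
    an algebraic integer.  It is rational because it is essentially the
    product of the values G(u_i) of a rational polynomial G, that is the
    determinant of G evaluated at the companion matrix of f
    ([prod_horner_roots_rat]).

    Finally M(f) M(g) <= M(P), because the Mahler measure M is multiplicative
    and at least 1 on integer polynomials, and M(P)^2 <= (d + 1) H(P)^2 by
    Landau's inequality ([landau]).  The explicit constant then comes from crude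
    estimates ([separation_constant_le]). *)

(** * Algebraic integers and products over pairs of roots *)

Definition integral (C : numClosedFieldType) (z : C) : Prop :=
  integralOver (intr : int -> C) z.

Lemma integral_intr (C : numClosedFieldType) (n : int) :
  integral (n%:~R : C).
Proof. exact: (integral_id (intr : {rmorphism int -> C})). Qed.

Lemma integral_natr (C : numClosedFieldType) (n : nat) : integral (n%:R : C).
Proof. exact: (integral_intr C n). Qed.

Lemma integral_M (C : numClosedFieldType) (z w : C) :
  integral z -> integral w -> integral (z * w).
Proof. exact: (@integral_mul _ _ (intr : {rmorphism int -> C})). Qed.

Lemma integral_B (C : numClosedFieldType) (z w : C) :
  integral z -> integral w -> integral (z - w).
Proof. exact: (@integral_sub _ _ (intr : {rmorphism int -> C})). Qed.

Lemma integral_D (C : numClosedFieldType) (z w : C) :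
  integral z -> integral w -> integral (z + w).
Proof. exact: (@integral_add _ _ (intr : {rmorphism int -> C})). Qed.

Lemma integral_X (C : numClosedFieldType) (z : C) n :
  integral z -> integral (z ^+ n).
Proof.
move=> iz; elim: n => [|n IHn]; first exact: (integral_intr C 1).
by rewrite exprS; apply: integral_M.
Qed.

Lemma integral_sign (C : numClosedFieldType) n : integral ((-1) ^+ n : C).
Proof. by apply: integral_X; apply: (integral_intr C (-1)). Qed.

Lemma integral_sum (C : numClosedFieldType) (I : Type) (r : seq I) (Q : pred I)
    (F : I -> C) :
  (forall i, Q i -> integral (F i)) -> integral (\sum_(i <- r | Q i) F i).
Proof.
move=> iF; elim/big_ind: _ => //; first exact: (integral_intr C 0).
exact: integral_D.
Qed.

Lemma integral_prod (C : numClosedFieldType) (I : Type) (r : seq I) (Q : pred I)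
    (F : I -> C) :
  (forall i, Q i -> integral (F i)) -> integral (\prod_(i <- r | Q i) F i).
Proof.
move=> iF; elim/big_ind: _ => //; first exact: (integral_intr C 1).
exact: integral_M.
Qed.

(** Multiplying p(c) = 0 by lead^(deg p - 1) gives an equation for lead * c
    which is monic and has integral coefficients. *)
Lemma integral_lead_root (C : numClosedFieldType) (p : {poly C}) (c : C) :
  (forall i, integral p`_i) -> root p c -> integral (lead_coef p * c).
Proof.
move=> ip pc0; have [->|p0] := eqVneq p 0.
  by rewrite lead_coef0 mul0r; apply: (integral_intr C 0).
have [n sp] : exists n, size p = n.+2.
  have : (1 < size p)%N by apply: root_size_gt1 pc0.
  by case: (size p) => [|[|n]] // _; exists n.
pose a := lead_coef p; have Ea : a = p`_n.+1 by rewrite /a lead_coefE sp.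
(* 'X^(n.+1) + r is p multiplied by a ^+ n and expressed in a * 'X. *)
pose r := \poly_(i < n.+1) (p`_i * a ^+ (n - i)).
have ltr : (size r < size ('X^(n.+1) : {poly C}))%N.
  by rewrite size_polyXn ltnS size_poly.
apply: (@integral_root_monic _ _ (intr : {rmorphism int -> C}) _
          ('X^(n.+1) + r)).
- by rewrite monicE lead_coefDl // lead_coefXn.
- rewrite rootE hornerD hornerXn horner_poly -/a.
  have: a ^+ n * p.[c] = 0 by rewrite (rootP pc0) mulr0.
  rewrite horner_coef sp big_ord_recr /= -Ea mulrDr mulrA -exprSr -exprMn.
  rewrite addrC mulr_sumr => E; rewrite -[X in _ == X]E; apply/eqP.
  congr (_ + _).
  apply: eq_bigr => i _.
  have -> : a ^+ n = a ^+ (n - i) * a ^+ i by rewrite -exprD subnK // -ltnS.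
  by rewrite exprMn; ring.
- apply/integral_poly => i; rewrite coefD coefXn coef_poly.
  apply: integral_D; first exact: integral_natr.
  case: ifP => _; last exact: (integral_intr C 0).
  by apply: integral_M => //; apply: integral_X; rewrite Ea.
Qed.

(** Induction on the degree of the quotient q: by [integral_lead_root], the
    polynomial lead * X^k * (X - c) has integral coefficients, so it can be
    subtracted from the product, which removes the leading term of q. *)
Lemma integral_coef_div (C : numClosedFieldType) (q : {poly C}) (c : C) :
  (forall i, integral (('X - c%:P) * q)`_i) -> forall i, integral q`_i.
Proof.
have [n] := ubnP (size q); elim: n q => // n IHn q; rewrite ltnS => sq ip i.
have [->|q0] := eqVneq q 0; first by rewrite coef0; apply: (integral_intr C 0).
set p := _ * q in ip.
have lp : lead_coef p = lead_coef q by rewrite lead_coefM lead_coefXsubC mul1r.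
have pc0 : root p c by rewrite /p rootM root_XsubC eqxx.
have ia : integral (lead_coef q) by rewrite -lp; apply: ip.
have ac := integral_lead_root ip pc0; rewrite lp in ac.
pose k := (size q).-1; pose q' := q - (lead_coef q) *: 'X^k.
have iq' : forall j, integral q'`_j.
  apply: IHn => [|j].
    apply: leq_trans sq; rewrite [X in (_ < X)%N]polySpred // ltnS.
    apply/leq_sizeP => j; rewrite leq_eqVlt => /predU1P[<-|ltj].
      by rewrite coefB coefZ coefXn eqxx mulr1 lead_coefE subrr.
    rewrite coefB coefZ coefXn gtn_eqF // mulr0 subr0 nth_default //.
    by rewrite polySpred.
  rewrite mulrBr -/p -scalerAr mulrBl -exprS mul_polyC scalerBr scalerA.
  rewrite coefB coefB !coefZ !coefXn.
  apply: integral_B => //; apply: integral_B; apply: integral_M => //;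
    exact: integral_natr.
have -> : q`_i = q'`_i + lead_coef q * (i == k)%:R.
  by rewrite coefB coefZ coefXn subrK.
apply: integral_D => //; apply: integral_M => //.
exact: integral_natr.
Qed.

(** Divide out the roots outside S one by one; the constant coefficient of
    what is left is the subproduct up to sign. *)
Lemma integral_subprod (C : numClosedFieldType) (a : C) m (s : 'I_m -> C)
    (S : pred 'I_m) :
  (forall i, integral (a *: \prod_i ('X - (s i)%:P))`_i) ->
  integral (a * \prod_(i | S i) s i).
Proof.
rewrite (bigID S) /= mulrC -big_filter => ia.
have {}ia i : integral (a *: \prod_(i < m | S i) ('X - (s i)%:P))`_i.
  elim: [seq _ <- _ | _] ia i => [|j l IHl] ia i; first by
    have := ia i; rewrite big_nil mul1r.
  apply: IHl => {}i; apply: integral_coef_div (s j) _ _ => {}i.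
  by rewrite -scalerAr mulrA; have := ia i; rewrite big_cons.
have := ia 0; rewrite coefZ -horner_coef0 horner_prod.
under eq_bigr do rewrite !hornerE /=.
rewrite prodrN => /(integral_M (integral_sign C #|[pred i | S i]|)).
by rewrite mulrCA signrMK.
Qed.

(** The monomial splits into n subproducts without repetition, each taking one
    factor a: the t-th one collects the roots with exponent larger than t. *)
Lemma integral_monomial (C : numClosedFieldType) (a : C) m (s : 'I_m -> C)
    (e : 'I_m -> nat) (n : nat) :
  (forall i, integral (a *: \prod_i ('X - (s i)%:P))`_i) ->
  (forall i, e i <= n)%N ->
  integral (a ^+ n * \prod_i s i ^+ e i).
Proof.
move=> ia le_e_n.
have -> : a ^+ n * \prod_i s i ^+ e i
    = \prod_(t < n) (a * \prod_(i | (t < e i)%N) s i).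
  rewrite big_split /= prodr_const card_ord; congr (_ * _).
  rewrite (exchange_big_dep xpredT) //=; apply: eq_bigr => i _.
  rewrite prodr_const; congr (_ ^+ _).
  by rewrite -sum1_card -(big_ord_widen _ (fun=> 1%N)) // sum1_card card_ord.
by apply: integral_prod => t _; apply: integral_subprod.
Qed.

Lemma prod_fst_card (K : comNzRingType) (I J : finType) (Q : pred (I * J))
    (F : I -> K) :
  \prod_(p | Q p) F p.1 = \prod_i F i ^+ #|[pred j | Q (i, j)]|.
Proof.
rewrite (eq_bigl (fun p => xpredT p.1 && Q (p.1, p.2))); last by case.
rewrite -(pair_big_dep xpredT (fun i j => Q (i, j)) (fun i _ => F i)) /=.
by apply: eq_bigr => i _; rewrite prodr_const.
Qed.

Lemma prod_snd_card (K : comNzRingType) (I J : finType) (Q : pred (I * J))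
    (F : J -> K) :
  \prod_(p | Q p) F p.2 = \prod_j F j ^+ #|[pred i | Q (i, j)]|.
Proof.
rewrite (eq_bigl (fun p => xpredT p.1 && Q (p.1, p.2))); last by case.
rewrite -(pair_big_dep xpredT (fun i j => Q (i, j)) (fun _ j => F j)) /=.
rewrite (exchange_big_dep xpredT) //=.
by apply: eq_bigr => i _; rewrite prodr_const.
Qed.

(** Expanding the product means choosing one end of each edge: the resulting
    monomial has exponent at most k in each u_i and at most l in each v_j, as
    these bound the numbers of edges at u_i and at v_j. *)
Lemma integral_edge_prod (C : numClosedFieldType) (a b z : C) m n
    (u : 'I_m -> C) (v : 'I_n -> C) (P : 'I_m -> 'I_n -> bool) (k l : nat) :
  (forall i, integral (a *: \prod_i ('X - (u i)%:P))`_i) ->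
  (forall i, integral (b *: \prod_j ('X - (v j)%:P))`_i) ->
  integral z ->
  (forall i, #|P i| <= k)%N -> (forall j, #|P^~ j| <= l)%N ->
  integral (a ^+ k * b ^+ l * \prod_(p | P p.1 p.2) (u p.1 - z * v p.2)).
Proof.
move=> ia ib iz rowP colP.
pose F (p : 'I_m * 'I_n) (t : bool) := if t then u p.1 else - z * v p.2.
have -> : \prod_(p | P p.1 p.2) (u p.1 - z * v p.2)
    = \prod_(p | P p.1 p.2) \sum_(t | true) F p t.
  by apply: eq_bigr => p _; rewrite big_bool /F /= mulNr.
rewrite (big_distr_big true) mulr_sumr /=; apply: integral_sum => phi _.
rewrite (bigID (fun p => phi p)) /=.
have -> : \prod_(p | P p.1 p.2 && phi p) F p (phi p)
    = \prod_i u i ^+ #|[pred j | P i j && phi (i, j)]|.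
  rewrite (eq_bigr (fun p => u p.1)); last first.
    by move=> p /andP[_]; rewrite /F => ->.
  by rewrite prod_fst_card.
have -> : \prod_(p | P p.1 p.2 && ~~ phi p) F p (phi p)
    = (\prod_(p | P p.1 p.2 && ~~ phi p) - z) *
      \prod_j v j ^+ #|[pred i | P i j && ~~ phi (i, j)]|.
  rewrite (eq_bigr (fun p => - z * v p.2)); last first.
    by move=> p /andP[_ /negbTE]; rewrite /F => ->.
  rewrite big_split /=; congr (_ * _).
  by rewrite prod_snd_card.
rewrite mulrACA; apply: integral_M.
  apply: integral_monomial => // i; apply: leq_trans (rowP i).
  apply: subset_leq_card; apply/fintype.subsetP => j.
  by rewrite !inE => /andP[].
rewrite mulrCA; apply: integral_M.
  apply: integral_prod => p _; rewrite -[- z]sub0r.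
  by apply: integral_B => //; apply: integral_natr 0%N.
apply: integral_monomial => // j; apply: leq_trans (colP j).
by apply: subset_leq_card; apply/fintype.subsetP => i; rewrite !inE => /andP[].
Qed.

(** * Rationality of products over pairs of roots *)

Lemma map_poly_intr_ratr (K : numFieldType) (p : {poly int}) :
  map_poly intr p = map_poly ratr (map_poly intr p : {poly rat}) :> {poly K}.
Proof.
by rewrite -map_poly_comp; apply: eq_map_poly => i /=; rewrite ratr_int.
Qed.

Lemma integral_rat_norm_ge1 (C : numClosedFieldType) (q : rat) :
  integral (ratr q : C) -> q != 0 -> 1 <= `|ratr q : C|.
Proof.
case=> p mon_p pq0 q0.
have pq : root (map_poly intr p) q.
  by move: pq0; rewrite map_poly_intr_ratr fmorph_root.
have qint : q \in Num.int.
  rewrite -Cint_rat; apply: Cint_rat_Aint; first exact: Crat_rat.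
  apply: (@root_monic_Aint (map_poly intr p)).
  - by rewrite map_poly_intr_ratr fmorph_root.
  - exact: monic_map.
  - apply/polyOverP => i. rewrite coef_map /=. exact: intr_int.
have /intrP[n En] := qint.
rewrite En ratr_int -intr_norm ler1z -gtz0_ge1 normr_gt0.
by move: q0; rewrite En intr_eq0.
Qed.

(** The product is the determinant of G evaluated at the companion matrix of f
    made monic: splitting G into factors X - z reduces this to the fact that
    the characteristic polynomial of this matrix has the roots u_i. *)
Lemma prod_horner_roots_rat (C : numClosedFieldType) (f G : {poly rat}) (a : C)
    m (u : 'I_m -> C) :
  f != 0 -> map_poly ratr f = a *: \prod_i ('X - (u i)%:P) ->
  exists q : rat, \prod_i (map_poly ratr G).[u i] = ratr q.
Proof.
move=> f0 fE.
have a0 : a != 0.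
  apply: contraNneq f0 => a0.
  by rewrite -(map_poly_eq0 (ratr : {rmorphism rat -> C})) fE a0 scale0r.
(* Square matrices form a ring only in positive dimension. *)
case: m u fE => [|m] u fE; first by exists 1; rewrite big_ord0 rmorph1.
pose f1 := (lead_coef f)^-1 *: f.
have mon_f1 : f1 \is monic by rewrite monicE lead_coefZ mulVf ?lead_coef_eq0.
have f1E : map_poly ratr f1 = \prod_i ('X - (u i)%:P).
  rewrite map_polyZ fE /= fmorphV -lead_coef_map fE lead_coefZ.
  by rewrite (monicP (monic_prod_XsubC _ _ _)) mulr1 scalerA mulVf // scale1r.
have sf1 : (size f1).-1 = m.+1.
  rewrite -(size_map_poly (ratr : {rmorphism rat -> C})) f1E size_prod_XsubC.
  by rewrite [index_enum _]unlock -enumT size_enum_ord.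
have [A chA] : exists A : 'M[rat]_(m.+1), char_poly A = f1.
  by rewrite -sf1; exists (companionmx f1); apply: companionmxK.
exists (\det (horner_mx A G)); rewrite -det_map_mx map_horner_mx.
set B := map_mx _ A; set g := map_poly _ G.
have chB : char_poly B = \prod_i ('X - (u i)%:P) by rewrite -map_char_poly chA.
have [t ->] := closed_field_poly_normal g; set b := lead_coef g.
have detB (z : C) : \det (horner_mx B ('X - z%:P)) = \prod_i (u i - z).
  have -> : horner_mx B ('X - z%:P) = - (z%:M - B).
    by rewrite rmorphB /= horner_mx_X horner_mx_C opprB.
  rewrite -scaleN1r detZ.
  have -> : \det (z%:M - B) = (char_poly B).[z].
    rewrite /char_poly -[RHS]/(horner_eval z _) -det_map_mx; congr (\det _).
    by apply/matrixP => i j; rewrite !mxE /= /horner_eval !(hornerE, hornerMn).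
  rewrite chB horner_prod -[X in _ ^+ X]card_ord -prodr_const -big_split /=.
  by apply: eq_bigr => i _; rewrite !hornerE mulN1r opprB.
rewrite linearZ /= detZ rmorph_prod /=.
have -> : \det (\prod_(z <- t) horner_mx B ('X - z%:P))
    = \prod_(z <- t) \prod_i (u i - z).
  elim: t => [|z t IHt]; first by rewrite !big_nil det1.
  by rewrite !big_cons det_mulmx IHt detB.
rewrite exchange_big /= -[X in _ ^+ X]card_ord -prodr_const -big_split /=.
apply: eq_bigr => i _; rewrite hornerZ horner_prod; congr (_ * _).
by apply: eq_bigr => z _; rewrite !hornerE.
Qed.

(** A rational algebraic integer is an integer. The polynomial G witnesses the
    rationality: up to the leading coefficient of g, its value at u_i is the
    product over the edges at u_i. *)
Lemma edge_prod_norm_ge1 (C : numClosedFieldType) (f g : {poly int})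
    (G : {poly rat}) (z : C) m n (u : 'I_m -> C) (v : 'I_n -> C)
    (P : 'I_m -> 'I_n -> bool) (k l : nat) :
  f != 0 -> g != 0 ->
  map_poly intr f = (lead_coef f)%:~R *: \prod_i ('X - (u i)%:P) ->
  map_poly intr g = (lead_coef g)%:~R *: \prod_j ('X - (v j)%:P) ->
  integral z ->
  (forall i, #|P i| <= k)%N -> (forall j, #|P^~ j| <= l)%N ->
  (forall i, (map_poly ratr G).[u i]
             = (lead_coef g)%:~R * \prod_(j | P i j) (u i - z * v j)) ->
  (forall i, (map_poly ratr G).[u i] != 0) ->
  1 <= `|(lead_coef f)%:~R ^+ k * (lead_coef g)%:~R ^+ l
         * \prod_(p | P p.1 p.2) (u p.1 - z * v p.2)|.
Proof.
move=> f0 g0 fE gE iz rowP colP GE Gn0.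
set a := lead_coef f; set b := lead_coef g; set V := _ * _.
have ra0 : a%:~R != 0 :> rat by rewrite intr_eq0 lead_coef_eq0.
have rb0 : b%:~R != 0 :> rat by rewrite intr_eq0 lead_coef_eq0.
have iV : integral V.
  apply: integral_edge_prod => // i.
    by rewrite -fE coef_map; apply: integral_intr.
  by rewrite -gE coef_map; apply: integral_intr.
have [q qE] : exists q : rat, \prod_i (map_poly ratr G).[u i] = ratr q.
  apply: (@prod_horner_roots_rat _ (map_poly intr f) G a%:~R).
    by rewrite map_poly_eq0_id0 ?intr_eq0 ?lead_coef_eq0.
  by rewrite -map_poly_intr_ratr fE.
have q0 : q != 0.
  rewrite -(fmorph_eq0 (ratr : {rmorphism rat -> C})) /= -qE prodf_seq_neq0.
  by apply/allP => i _ /=; apply: Gn0.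
have VE : V = ratr (a%:~R ^+ k * b%:~R ^+ l * (q / b%:~R ^+ m)).
  rewrite !(rmorphM, rmorphXn, fmorphV) /= !ratr_int -qE; congr (_ * _).
  under [in RHS]eq_bigr do rewrite GE.
  rewrite big_split /= prodr_const card_ord mulrC mulKf; last first.
    by rewrite expf_neq0 // intr_eq0 lead_coef_eq0.
  by rewrite (pair_big_dep xpredT P (fun i j => u i - z * v j)).
rewrite VE in iV *; apply: integral_rat_norm_ge1 => //.
by rewrite !mulf_neq0 ?invr_neq0 ?expf_neq0.
Qed.

(** * The Mahler measure *)

Definition max1_norm (C : numClosedFieldType) (z : C) : C := Num.max 1 `|z|.

Lemma max1_norm_ge1 (C : numClosedFieldType) (z : C) : 1 <= max1_norm z.
Proof.
rewrite /max1_norm maxElt; case: ifP => [/ltW //|_]; exact: lexx.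
Qed.

Lemma max1_norm_ge (C : numClosedFieldType) (z : C) : `|z| <= max1_norm z.
Proof.
by rewrite /max1_norm maxElt; case: real_ltP => //; rewrite ?real1 ?normr_real.
Qed.

Lemma max1_norm_ge0 (C : numClosedFieldType) (z : C) : 0 <= max1_norm z.
Proof. exact: le_trans ler01 (max1_norm_ge1 z). Qed.

(** The value does not depend on the factorization chosen here: see [mahlerE].
    *)
Definition mahler (C : numClosedFieldType) (p : {poly C}) : C :=
  `|lead_coef p| * \prod_(z <- sval (closed_field_poly_normal p)) max1_norm z.

Lemma mahlerE (C : numClosedFieldType) (a : C) (s : seq C) :
  a != 0 ->
  mahler (a *: \prod_(z <- s) ('X - z%:P)) = `|a| * \prod_(z <- s) max1_norm z.
Proof.
move=> a0; rewrite /mahler; case: (closed_field_poly_normal _) => t /=.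
rewrite lead_coefZ (monicP (monic_prod_XsubC _ _ _)) mulr1 => /(scalerI a0) E.
by congr (_ * _); apply: perm_big; rewrite perm_sym; apply: prod_XsubC_eq.
Qed.

Lemma mahlerE_ord (C : numClosedFieldType) (a : C) m (u : 'I_m -> C) :
  a != 0 ->
  mahler (a *: \prod_i ('X - (u i)%:P)) = `|a| * \prod_i max1_norm (u i).
Proof.
move=> a0; have := mahlerE [seq u i | i <- index_enum 'I_m] a0.
by rewrite !big_map.
Qed.

Lemma mahlerM (C : numClosedFieldType) (p q : {poly C}) :
  p != 0 -> q != 0 -> mahler (p * q) = mahler p * mahler q.
Proof.
move=> p0 q0; rewrite {2 3}/mahler.
case: (closed_field_poly_normal p) => s /= sE.
case: (closed_field_poly_normal q) => t /= tE.
rewrite mulrACA -normrM -big_cat -mahlerE ?mulf_neq0 ?lead_coef_eq0 //.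
by rewrite big_cat /= -scalerA scalerAr -tE scalerAl -sE.
Qed.

Lemma mahler_ge1 (C : numClosedFieldType) (f : {poly int}) :
  f != 0 -> 1 <= mahler (map_poly intr f : {poly C}).
Proof.
move=> f0; apply: mulr_ege1; last first.
  by elim/big_ind: _ => // [x y|i _]; [apply: mulr_ege1|apply: max1_norm_ge1].
rewrite lead_coef_map_inj //; last exact: intr_inj.
by rewrite -intr_norm ler1z -gtz0_ge1 normr_gt0 lead_coef_eq0.
Qed.

Lemma int_poly_splits (C : numClosedFieldType) (f : {poly int}) :
  f != 0 -> exists u : 'I_(size f).-1 -> C,
    map_poly intr f = (lead_coef f)%:~R *: \prod_i ('X - (u i)%:P).
Proof.
move=> f0; have [s sE] := closed_field_poly_normal (map_poly intr f : {poly C}).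
have fiE : lead_coef (map_poly intr f : {poly C}) = (lead_coef f)%:~R.
  by rewrite lead_coef_map_inj //; exact: intr_inj.
rewrite fiE in sE.
have ss : size s = (size f).-1.
  have := congr1 (fun p : {poly C} => (size p).-1) sE.
  rewrite size_scale ?intr_eq0 ?lead_coef_eq0 // size_prod_XsubC /= => <-.
  by rewrite size_map_inj_poly //; apply: intr_inj.
exists (fun i => s`_i); rewrite sE -ss; congr (_ *: _).
by rewrite (big_nth 0) big_mkord.
Qed.

(** * Lower bounds from products over pairs of roots *)

(** Each factor is at most 2 max(1, |u_i|) max(1, |v_j|); those with indices
    in S are counted with their exact size delta. *)
Lemma edge_prod_norm_le (C : numClosedFieldType) (z delta : C) m n
    (u : 'I_m -> C) (v : 'I_n -> C) (P : 'I_m -> 'I_n -> bool)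
    (S : {set 'I_m * 'I_n}) (k l : nat) :
  `|z| <= 1 ->
  (forall i, #|P i| <= k)%N -> (forall j, #|P^~ j| <= l)%N ->
  (forall p, p \in S -> P p.1 p.2 /\ `|u p.1 - z * v p.2| = delta) ->
  `|\prod_(p | P p.1 p.2) (u p.1 - z * v p.2)|
    <= delta ^+ #|S| * ((2 ^ (m * k))%:R * (\prod_i max1_norm (u i)) ^+ k
                        * (\prod_j max1_norm (v j)) ^+ l).
Proof.
move=> z1 rowP colP SP.
pose w p := if p \in S then delta else 1.
have w_ge0 p : 0 <= w p.
  by rewrite /w; case: ifP => // /SP[_ <-].
have le_w p : `|u p.1 - z * v p.2|
    <= w p * ((2 * max1_norm (u p.1)) * max1_norm (v p.2)).
  rewrite /w; case: ifP => [/SP[_ E]|_].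
    rewrite E ler_peMr //; first by rewrite -E.
    by rewrite mulr_ege1 ?max1_norm_ge1 // mulr_ege1 ?max1_norm_ge1 // ler1n.
  rewrite mul1r; apply: le_trans (ler_normB _ _) _.
  rewrite -mulrA mulr_natl mulr2n; apply: lerD.
    rewrite -[X in X <= _]mulr1.
    by apply: ler_pM => //; [apply: max1_norm_ge|apply: max1_norm_ge1].
  rewrite normrM; apply: ler_pM => //; last exact: max1_norm_ge.
  exact: le_trans z1 (max1_norm_ge1 _).
rewrite normr_prod; apply: (@le_trans _ _
    (\prod_(p | P p.1 p.2)
       (w p * ((2 * max1_norm (u p.1)) * max1_norm (v p.2))))).
  by apply: ler_prod => p _; rewrite normr_ge0 le_w.
rewrite big_split /=.
have -> : \prod_(p | P p.1 p.2) w p = delta ^+ #|S|.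
  rewrite -big_mkcondr prodr_const; congr (_ ^+ _); apply: eq_card => p.
  by rewrite unfold_in /= andb_idl // => /SP[].
have wS_ge0 : 0 <= delta ^+ #|S|.
  have [->|[p pS]] := set_0Vmem S; first by rewrite cards0 expr0 ler01.
  by rewrite exprn_ge0 //; have [_ <-] := SP p pS.
apply: ler_wpM2l => //; rewrite big_split /=.
rewrite (prod_fst_card (fun p => P p.1 p.2) (fun i => 2 * max1_norm (u i))).
rewrite (prod_snd_card (fun p => P p.1 p.2) (fun j => max1_norm (v j))).
have two_max1_ge1 i : 1 <= 2 * max1_norm (u i).
  by rewrite mulr_ege1 ?max1_norm_ge1 // ler1n.
have -> : (2 ^ (m * k))%:R * (\prod_i max1_norm (u i)) ^+ k
    = \prod_i (2 * max1_norm (u i)) ^+ k.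
  rewrite prodrXl big_split /= exprMn prodr_const card_ord.
  by rewrite -exprM natrX.
rewrite -prodrXl; apply: ler_pM.
- by apply: prodr_ge0 => i _; rewrite exprn_ge0 // (le_trans ler01).
- by apply: prodr_ge0 => j _; rewrite exprn_ge0 // max1_norm_ge0.
- apply: ler_prod => i _; rewrite exprn_ge0 ?(le_trans ler01) //=.
  by apply: ler_weXn2l => //; apply: rowP.
- apply: ler_prod => j _; rewrite exprn_ge0 ?max1_norm_ge0 //=.
  by apply: ler_weXn2l; [apply: max1_norm_ge1|apply: colP].
Qed.

(** The set S gathers the edges whose factor is the quantity to be bounded
    from below. It has two elements for sums and differences of conjugates,
    where (i, j) and (j, i) are both edges, and this is why the exponent of
    the height is halved there. *)
Lemma edge_prod_gap (C : numClosedFieldType) (f g : {poly int})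
    (G : {poly rat}) (z delta : C) m n (u : 'I_m -> C) (v : 'I_n -> C)
    (P : 'I_m -> 'I_n -> bool) (S : {set 'I_m * 'I_n}) (k l : nat) :
  f != 0 -> g != 0 ->
  map_poly intr f = (lead_coef f)%:~R *: \prod_i ('X - (u i)%:P) ->
  map_poly intr g = (lead_coef g)%:~R *: \prod_j ('X - (v j)%:P) ->
  integral z -> `|z| <= 1 ->
  (forall i, #|P i| <= k)%N -> (forall j, #|P^~ j| <= l)%N ->
  (forall i, (map_poly ratr G).[u i]
             = (lead_coef g)%:~R * \prod_(j | P i j) (u i - z * v j)) ->
  (forall i, (map_poly ratr G).[u i] != 0) ->
  (forall p, p \in S -> P p.1 p.2 /\ `|u p.1 - z * v p.2| = delta) ->
  1 <= delta ^+ #|S| * ((2 ^ (m * k))%:R * mahler (map_poly intr f) ^+ k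
                        * mahler (map_poly intr g) ^+ l).
Proof.
move=> f0 g0 fE gE iz z1 rowP colP GE Gn0 SP.
have V1 := edge_prod_norm_ge1 f0 g0 fE gE iz rowP colP GE Gn0.
have V2 := edge_prod_norm_le z1 rowP colP SP.
apply: le_trans V1 _; rewrite normrM.
rewrite fE gE !mahlerE_ord ?intr_eq0 ?lead_coef_eq0 // !exprMn.
apply: le_trans (ler_wpM2l (normr_ge0 _) V2) _.
rewrite normrM !normrX le_eqVlt; apply/orP; left; apply/eqP; ring.
Qed.

(** * Landau's inequality *)

(** The core of Landau's inequality: X - c and c^* X - 1 have the same modulus
    on the unit circle, so that exchanging them keeps the sum of the squares
    of the moduli of the coefficients. For partial sums a boundary term
    remains. *)
Lemma flip_root_coef_sum (C : numClosedFieldType) (c : C) (q : {poly C}) N :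
  \sum_(i < N.+1) `|(('X - c%:P) * q)`_i| ^+ 2
  - \sum_(i < N.+1) `|((c^* *: 'X - 1) * q)`_i| ^+ 2
  = (`|c| ^+ 2 - 1) * `|q`_N| ^+ 2.
Proof.
have coefL i : (('X - c%:P) * q)`_i
    = (if i == 0 then 0 else q`_i.-1) - c * q`_i.
  by rewrite mulrBl coefB coefXM coefCM.
have coefR i : ((c^* *: 'X - 1) * q)`_i
    = c^* * (if i == 0 then 0 else q`_i.-1) - q`_i.
  by rewrite mulrBl mul1r coefB -scalerAl coefZ coefXM.
elim: N => [|N IHN].
  rewrite !big_ord_recr !big_ord0 /= coefL coefR /= mulr0 !add0r !normrN.
  by rewrite normrM exprMn; ring.
rewrite big_ord_recr [X in _ - X]big_ord_recr /= opprD addrACA IHN.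
rewrite coefL coefR /=.
rewrite !normCK !(rmorphB, rmorphM) /= conjCK.
ring.
Qed.

(** Replace each factor X - z with |z| > 1 by z^* X - 1: the sum of squares is
    unchanged, while the leading coefficient grows by |z|. At the end its
    modulus is the Mahler measure, and its square is one of the summands. The
    polynomial q accumulates the factors already treated. *)
Lemma landau (C : numClosedFieldType) (s : seq C) (q : {poly C}) (N : nat) :
  (size (q * \prod_(z <- s) ('X - z%:P))%R <= N)%N ->
  (`|lead_coef q| * \prod_(z <- s) max1_norm z) ^+ 2
  <= \sum_(i < N) `|(q * \prod_(z <- s) ('X - z%:P))`_i| ^+ 2.
Proof.
have [->|q0] := eqVneq q 0.
  rewrite lead_coef0 normr0 !mul0r expr0n => _.
  by apply: sumr_ge0 => i _; rewrite exprn_ge0.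
elim: s q q0 N => [|c s IHs] q q0 N.
  rewrite !big_nil !mulr1 => sq; rewrite lead_coefE.
  have ltN : ((size q).-1 < N)%N.
    by apply: leq_trans sq; rewrite ltn_predL size_poly_gt0.
  rewrite (bigD1 (Ordinal ltN)) //= lerDl.
  by apply: sumr_ge0 => i _; rewrite exprn_ge0.
rewrite !big_cons; set t := \prod_(z <- s) ('X - z%:P).
have t0 : t != 0 by rewrite monic_neq0 // monic_prod_XsubC.
have [c1|c1] := real_leP (normr_real c) (@real1 C).
  have -> : max1_norm c = 1.
    rewrite /max1_norm maxElt; case: real_ltP; rewrite ?real1 ?normr_real //.
    by move=> /(le_lt_trans c1); rewrite ltxx.
  rewrite mul1r mulrA => sN.
  have qc0 : q * ('X - c%:P) != 0 by rewrite mulf_neq0 ?polyXsubC_eq0.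
  by have := IHs _ qc0 N sN; rewrite lead_coef_Mmonic ?monicXsubC.
have muc : max1_norm c = `|c| by rewrite /max1_norm maxElt c1.
have c0 : c != 0 by rewrite -normr_gt0 (lt_trans ltr01).
have s1 : size (1 : {poly C}) = 1%N by rewrite size_poly1.
pose r := c^* *: 'X - 1 : {poly C}.
have sr : size r = 2%N.
  by rewrite /r size_polyDl size_scale ?conjC_eq0 ?size_polyX // size_polyN s1.
have lr : lead_coef r = c^*.
  rewrite lead_coefDl; first by rewrite lead_coefZ lead_coefX mulr1.
  by rewrite size_polyN s1 size_scale ?conjC_eq0 ?size_polyX.
have r0 : r != 0 by rewrite -size_poly_gt0 sr.
have p0 : q * (('X - c%:P) * t) != 0 by rewrite !mulf_neq0 ?polyXsubC_eq0.
case: N => [|N] sN; first by rewrite leqn0 size_poly_eq0 (negPf p0) in sN.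
(* The boundary term vanishes because N is beyond the degree of q * t. *)
have qtN : (q * t)`_N = 0.
  apply: nth_default; move: sN.
  rewrite mulrCA size_mul ?polyXsubC_eq0 ?mulf_neq0 // size_XsubC.
  by rewrite addSn add1n ltnS.
have E := flip_root_coef_sum c (q * t) N.
move: E; rewrite qtN normr0 expr0n mulr0 => /eqP; rewrite subr_eq0 => /eqP E.
rewrite [q * _]mulrCA E -/r [r * _]mulrCA mulrA muc.
have := IHs (q * r) (mulf_neq0 q0 r0) N.+1.
rewrite lead_coefM lr normrM norm_conjC mulrA; apply.
apply: leq_trans sN; rewrite -/t mulrAC mulrC [q * _]mulrCA.
by rewrite !size_mul ?polyXsubC_eq0 ?mulf_neq0 // sr size_XsubC.
Qed.

Lemma mahler_sq_le_height (C : numClosedFieldType) (P : {poly int}) :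
  mahler (map_poly intr P : {poly C}) ^+ 2
  <= (size P)%:R * (height P)%:R ^+ 2.
Proof.
rewrite /mahler; case: (closed_field_poly_normal _) => s /= sE.
set a := lead_coef _ in sE *.
have := @landau _ s a%:P (size P); rewrite mul_polyC -sE lead_coefC.
rewrite size_map_inj_poly //; last exact: intr_inj.
move=> /(_ (leqnn _))/le_trans; apply.
rewrite mulr_natl -[X in _ *+ X]card_ord -sumr_const; apply: ler_sum => i _.
rewrite lerXn2r ?nnegrE ?ler0n // coef_map /= -intr_norm.
rewrite -[(height P)%:R]/((height P)%:~R) ler_int.
by rewrite -abszE lez_nat; apply: (leq_bigmax i).
Qed.

(** * Minimal polynomials over the integers *)

(** Up to a rational factor, f is the minimal polynomial of x over Q. *)
Definition minimal_at (C : numClosedFieldType) (f : {poly int}) (x : C) :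
    Prop :=
  [/\ f != 0, root (map_poly intr f) x &
      forall q : {poly rat}, root (map_poly ratr q) x -> map_poly intr f %| q].

(** A rational polynomial of least degree vanishing at x divides P over Q, and
    Gauss's lemma makes the factorization integral. *)
Lemma minimal_at_root (C : numClosedFieldType) (P : {poly int}) (x : C) :
  P != 0 -> root (map_poly intr P) x ->
  exists f r : {poly int}, P = f * r /\ minimal_at f x.
Proof.
move=> P0 Px.
have [h [h0 hx hmin]] : exists h : {poly rat}, [/\ h != 0,
    root (map_poly ratr h) x &
    forall q : {poly rat}, root (map_poly ratr q) x -> h %| q].
  pose Q : {poly rat} := map_poly intr P.
  have: root (map_poly ratr Q) x by rewrite -map_poly_intr_ratr.
  have: Q != 0 by rewrite map_poly_eq0_id0 ?intr_eq0 ?lead_coef_eq0.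
  have [n] := ubnP (size Q); elim: n (Q) => // n IHn h.
  rewrite ltnS => sh h0 hx.
  have [hmin|] := pselect
      (forall q : {poly rat}, root (map_poly ratr q) x -> h %| q).
    by exists h.
  move=> /existsNP[q /not_implyP[qx /negP nhq]].
  apply: (IHn (q %% h)) => //.
    by apply: leq_trans sh; rewrite ltn_modp.
  have := qx; rewrite {1}(divp_eq q h) rmorphD rmorphM /= !rootE.
  rewrite hornerD hornerM.
  by rewrite (rootP hx) mulr0 add0r.
have /dvdpP_rat_int[f [c c0 hE] [r PE]] : h %| map_poly intr P.
  by apply: hmin; rewrite -map_poly_intr_ratr.
exists f, r; split => //; split.
- by move: P0; rewrite PE mulf_eq0 negb_or => /andP[].
- rewrite map_poly_intr_ratr; move: hx; rewrite hE map_polyZ /= rootZ //.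
  by rewrite fmorph_eq0.
- by move=> q /hmin; rewrite hE dvdpZl.
Qed.

(** This is the irreducibility of f. If q vanishes at the conjugate z, the gcd
    h of f and q is not constant; the cofactor f / h has smaller degree than
    f, so that it does not vanish at x, hence h does. *)
Lemma minimal_at_conj (C : numClosedFieldType) (f : {poly int}) (x z : C) :
  minimal_at f x -> root (map_poly intr f) z -> minimal_at f z.
Proof.
move=> [f0 fx fmin] fz; split => // q qz.
pose F : {poly rat} := map_poly intr f.
have F0 : F != 0 by rewrite map_poly_eq0_id0 ?intr_eq0 ?lead_coef_eq0.
pose h := gcdp F q.
have hz : root (map_poly ratr h) z.
  by rewrite gcdp_map root_gcd qz -map_poly_intr_ratr fz.
have sh : (1 < size h)%N.
  rewrite -(size_map_poly (ratr : {rmorphism rat -> C})).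
  apply: (root_size_gt1 _ hz).
  by rewrite map_poly_eq0 gcdp_eq0 negb_and F0.
have : h %| F by apply: dvdp_gcdl.
case/dvdpP => k FE.
have k0 : k != 0 by apply: contraNneq F0 => k0; rewrite FE k0 mul0r.
have h0 : h != 0 by rewrite -size_poly_gt0 (ltn_trans _ sh).
have : root (map_poly ratr F) x by rewrite -map_poly_intr_ratr.
rewrite FE rmorphM rootM => /orP[kx|hx]; last first.
  by apply: dvdp_trans (fmin _ hx) (dvdp_gcdr _ _).
have /dvdp_leq := fmin k kx; rewrite -/F FE => /(_ k0).
rewrite size_mul // leqNgt; case/negP.
case: (size h) sh (size k) => [|[|n]] // _ m.
by rewrite !addnS /= ltnS leq_addr.
Qed.

Lemma minimal_at_size (C : numClosedFieldType) (f : {poly int}) (x : C) :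
  (forall q : rat, x != ratr q) -> minimal_at f x -> (2 < size f)%N.
Proof.
move=> xirr [f0 fx _]; rewrite ltnNge; apply/negP => sf.
have fi1 : size (map_poly intr f : {poly C}) = size f.
  by rewrite size_map_inj_poly //; apply: intr_inj.
have s2 : size f = 2%N.
  apply/eqP; rewrite eqn_leq sf /= -fi1; apply: root_size_gt1 fx.
  by rewrite -size_poly_gt0 fi1 size_poly_gt0.
move: fx; rewrite rootE horner_coef fi1 s2 !big_ord_recl big_ord0 /=.
rewrite !coef_map /=.
rewrite expr0 expr1 mulr1 addr0 addrC addr_eq0 => /eqP; rewrite /bump /= => E.
have f1 : f`_1 != 0 by rewrite -[1%N]/(2.-1) -s2 -lead_coefE lead_coef_eq0.
have := xirr (- (f`_0)%:~R / (f`_1)%:~R).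
rewrite rmorphM fmorphV rmorphN /= !ratr_int -E mulrC mulKf ?eqxx //.
by rewrite intr_eq0.
Qed.

(** * The three kinds of products *)

Lemma deriv_prod_XsubC (K : fieldType) (a : K) m (u : 'I_m -> K) (i : 'I_m) :
  (a *: \prod_j ('X - (u j)%:P))^`().[u i]
  = a * \prod_(j | j != i) (u i - u j).
Proof.
rewrite derivZ hornerZ (bigD1 i) //= derivM hornerD !hornerM.
rewrite derivXsubC hornerXsubC subrr mul0r addr0 hornerC mul1r horner_prod.
by congr (_ * _); apply: eq_bigr => j _; rewrite hornerXsubC.
Qed.

Lemma root_int_splits (C : numClosedFieldType) (f : {poly int}) m
    (u : 'I_m -> C) (x : C) :
  f != 0 ->
  map_poly intr f = (lead_coef f)%:~R *: \prod_i ('X - (u i)%:P) ->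
  root (map_poly intr f) x <-> exists i, x = u i.
Proof.
move=> f0 fE; rewrite fE rootZ ?intr_eq0 ?lead_coef_eq0 //.
rewrite rootE horner_prod; split=> [/prodf_eq0 /= [i _]|[i ->]].
  by rewrite hornerXsubC subr_eq0 => /eqP; exists i.
by rewrite (bigD1 i) //= hornerXsubC subrr mul0r.
Qed.

(** For f = g the graph joins all pairs of distinct indices, so that each of
    the m roots has m - 1 edges on either side. *)
Lemma same_poly_gap (C : numClosedFieldType) (f : {poly int}) (G : {poly rat})
    (x y : C) (e : bool) (m := (size f).-1) (u : 'I_m -> C) :
  f != 0 ->
  map_poly intr f = (lead_coef f)%:~R *: \prod_i ('X - (u i)%:P) ->
  root (map_poly intr f) x -> root (map_poly intr f) y -> x != y ->
  (forall i, (map_poly ratr G).[u i]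
       = (lead_coef f)%:~R * \prod_(j | j != i) (u i - (-1) ^+ e * u j)) ->
  (forall i, (map_poly ratr G).[u i] != 0) ->
  1 <= `|x - (-1) ^+ e * y| ^+ 2
       * ((2 ^ (m * m.-1))%:R * mahler (map_poly intr f) ^+ m.-1
          * mahler (map_poly intr f) ^+ m.-1).
Proof.
move=> f0 fE fx fy xy GE Gn0.
have /(root_int_splits x f0 fE) [i0 xE] := fx.
have /(root_int_splits y f0 fE) [j0 yE] := fy.
have ij : i0 != j0 by apply: contraNneq xy; rewrite xE yE => ->.
pose S := [set (i0, j0); (j0, i0)].
have S2 : #|S| = 2%N by rewrite cards2 xpair_eqE negb_and ij.
have rowP (i : 'I_m) : (#|(fun j : 'I_m => j != i)| <= m.-1)%N.
  by rewrite -[X in (_ <= X.-1)%N]card_ord -(cardC1 i).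
have := @edge_prod_gap _ f f G ((-1) ^+ e) `|x - (-1) ^+ e * y| m m u u
  (fun i j => j != i) S m.-1 m.-1 f0 f0 fE fE.
rewrite S2; apply => //.
- exact: integral_sign.
- by rewrite normr_sign.
- move=> j; apply: leq_trans (rowP j).
  apply: subset_leq_card; apply/fintype.subsetP => i.
  by rewrite !unfold_in eq_sym.
- move=> p; rewrite !inE => /orP[]/eqP -> /=; rewrite xE yE.
    by rewrite eq_sym.
  split => //; case: e {GE}; last by rewrite expr0 !mul1r distrC.
  by rewrite expr1 !mulN1r !opprK addrC.
Qed.

(** Take G = f': the minimality of f shows that f' does not vanish at its
    roots. *)
Lemma conjugates_bound (C : numClosedFieldType) (f : {poly int}) (x y : C)
    (m := (size f).-1) :
  minimal_at f x -> root (map_poly intr f) y -> x != y ->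
  1 <= `|x - y| ^+ 2
       * ((2 ^ (m * m.-1))%:R * mahler (map_poly intr f) ^+ m.-1
          * mahler (map_poly intr f) ^+ m.-1).
Proof.
move=> fmin fy xy; have [f0 fx _] := fmin.
have [u fE] := int_poly_splits C f0.
have G_E : map_poly ratr (map_poly intr f)^`()
    = (map_poly intr f)^`() :> {poly C}.
  by rewrite -deriv_map -map_poly_intr_ratr.
rewrite -[y]mul1r -[X in X * y](expr0 (-1)).
apply: (same_poly_gap (e := false) f0 fE fx fy xy
          (G := (map_poly intr f)^`())) => i; rewrite G_E.
  rewrite fE deriv_prod_XsubC; congr (_ * _).
  by apply: eq_bigr => j _; rewrite mul1r.
have /(minimal_at_conj fmin)[_ _ imin] : root (map_poly intr f) (u i).
  by apply/(root_int_splits _ f0 fE); exists i.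
rewrite -rootE -G_E; apply/negP => /imin.
set F := map_poly _ f.
have sF : size F = size f by rewrite size_map_inj_poly //; apply: intr_inj.
have F0 : F != 0 by rewrite -size_poly_gt0 sF size_poly_gt0.
have dF0 : F^`() != 0.
  have sf1 : (1 < size f)%N.
    rewrite -(size_map_inj_poly (intr_inj : injective (intr : int -> C))) //.
    apply: (root_size_gt1 _ fx).
    rewrite -size_poly_gt0 size_map_inj_poly ?size_poly_gt0 //; exact: intr_inj.
  apply: contraTneq F0 => dF; rewrite negbK -lead_coef_eq0 lead_coefE sF.
  have := coef_deriv F (size f).-2; rewrite dF coef0.
  case: (size f) sf1 => [|[|k]] //= _ /esym/eqP.
  by rewrite mulrn_eq0.
by move/dvdp_leq => /(_ dF0); rewrite leqNgt lt_size_deriv.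
Qed.

(** The value f(-u_i) is the product of a and of all -(u_i + u_j), including
    the unwanted factor -2 u_i for j = i. Since f(-w) = f(w) - 2 w h(w) where
    w h(w) is the odd part of f, the factor is removed by taking G = h up to
    sign. If h vanished at a root of f, then f would divide h, and f(-y) would
    be f(y) = 0. *)
Lemma sum_conjugates_bound (C : numClosedFieldType) (f : {poly int}) (x y : C)
    (m := (size f).-1) :
  (2 < size f)%N -> minimal_at f x -> root (map_poly intr f) y ->
  ~~ root (map_poly intr f) (- y) -> x != y ->
  1 <= `|x + y| ^+ 2
       * ((2 ^ (m * m.-1))%:R * mahler (map_poly intr f) ^+ m.-1
          * mahler (map_poly intr f) ^+ m.-1).
Proof.
move=> sf fmin fy fNy xy; have [f0 fx _] := fmin.
have [u fE] := int_poly_splits C f0.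
pose F : {poly rat} := map_poly intr f.
pose h := odd_poly F \Po 'X^2.
have F_odd (w : C) : (map_poly intr f).[- w] =
    (map_poly intr f).[w] - 2 * w * (map_poly ratr h).[w].
  have -> : map_poly intr f
      = map_poly ratr (even_poly F \Po 'X^2) + map_poly ratr h * 'X :> {poly C}.
    rewrite map_poly_intr_ratr -/F -{1}(poly_even_odd F) rmorphD rmorphM /=.
    by rewrite map_polyX.
  rewrite /h !map_comp_poly map_polyXn.
  by rewrite !(hornerD, hornerM, horner_comp, hornerX, hornerXn) mulrNN; ring.
have uroot i : root (map_poly intr f) (u i).
  by apply/(root_int_splits _ f0 fE); exists i.
have hn0 i : (map_poly ratr h).[u i] != 0.
  have [_ _ imin] := minimal_at_conj fmin (uroot i).
  rewrite -rootE; apply/negP => /imin /dvdpP[k hE].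
  have hy : (map_poly ratr h).[y] = 0.
    rewrite hE rmorphM hornerM /= -map_poly_intr_ratr.
    by rewrite (rootP fy) mulr0.
  by move: fNy; rewrite rootE F_odd (rootP fy) hy mulr0 subrr eqxx.
have un0 i : u i != 0.
  have [_ _ imin] := minimal_at_conj fmin (uroot i).
  apply/negP => /eqP ui0.
  have /imin : root (map_poly ratr 'X) (u i).
    by rewrite map_polyX ui0 rootX.
  move/dvdp_leq; rewrite polyX_eq0 size_polyX => /(_ isT).
  rewrite size_map_inj_poly //; last exact: intr_inj.
  by rewrite leqNgt sf.
have hE i : (map_poly ratr h).[u i]
    = (-1) ^+ m.-1 * ((lead_coef f)%:~R * \prod_(j | j != i) (u i + u j)).
  have := F_odd (u i); rewrite (rootP (uroot i)) sub0r {1}fE hornerZ.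
  rewrite horner_prod (bigD1 i) //= hornerXsubC.
  have -> : \prod_(j | j != i) ('X - (u j)%:P).[- u i]
      = (-1) ^+ m.-1 * \prod_(j | j != i) (u i + u j).
    transitivity (\prod_(j in predC1 i) - (u i + u j)).
      by apply: eq_big => [j|j _]; rewrite ?inE // hornerXsubC opprD.
    by rewrite prodrN cardC1 card_ord.
  move=> E; have u2 : - (2 * u i) != 0 by rewrite oppr_eq0 mulf_neq0 ?pnatr_eq0.
  apply: (mulfI u2); rewrite mulNr -E; ring.
have GE i : (map_poly ratr ((-1) ^+ m.-1 *: h)).[u i]
    = (lead_coef f)%:~R * \prod_(j | j != i) (u i - (-1) ^+ true * u j).
  rewrite map_polyZ hornerZ /= rmorphXn rmorphN1 hE signrMK.
  by congr (_ * _); apply: eq_bigr => j _; rewrite expr1 mulN1r opprK.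
have -> : x + y = x - (-1) ^+ true * y by rewrite expr1 mulN1r opprK.
apply: (same_poly_gap f0 fE fx fy xy GE) => i.
by rewrite map_polyZ hornerZ /= rmorphXn rmorphN1 mulf_neq0 // signr_eq0.
Qed.

(** Take G(X) = g(z X) up to sign, with z = (-1)^e. If it vanished at a root u
    of f, then z u would be a conjugate of y at which f(z X) vanishes, so g
    would divide f(z X) and f would vanish at z y. *)
Lemma coprime_bound (C : numClosedFieldType) (f g : {poly int}) (x y : C)
    (e : bool) (m := (size f).-1) (n := (size g).-1) :
  minimal_at f x -> minimal_at g y ->
  ~~ root (map_poly intr f) ((-1) ^+ e * y) ->
  1 <= `|x - (-1) ^+ e * y|
       * ((2 ^ (m * n))%:R * mahler (map_poly intr f) ^+ n
          * mahler (map_poly intr g) ^+ m).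
Proof.
move=> fmin gmin fNy; have [f0 fx _] := fmin; have [g0 gy _] := gmin.
have [u fE] := int_poly_splits C f0.
have [v gE] := int_poly_splits C g0.
have /(root_int_splits x f0 fE) [i0 xE] := fx.
have /(root_int_splits y g0 gE) [j0 yE] := gy.
pose scale (p : {poly rat}) := p \Po ((-1) ^+ e *: 'X).
have scaleE p (w : C) :
    (map_poly ratr (scale p)).[w] = (map_poly ratr p).[(-1) ^+ e * w].
  rewrite map_comp_poly horner_comp map_polyZ map_polyX hornerZ hornerX /=.
  by rewrite rmorphXn rmorphN1.
have g_ne0 i : (map_poly intr g).[(-1) ^+ e * u i] != 0.
  rewrite -rootE; apply/negP => /(minimal_at_conj gmin) [_ _ imin].
  have : root (map_poly ratr (scale (map_poly intr f))) ((-1) ^+ e * u i).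
    rewrite rootE scaleE signrMK -map_poly_intr_ratr -rootE.
    by apply/(root_int_splits _ f0 fE); exists i.
  move=> /imin /dvdpP[k kE]; case/negP: fNy.
  rewrite rootE map_poly_intr_ratr -scaleE kE rmorphM hornerM /=.
  by rewrite -map_poly_intr_ratr (rootP gy) mulr0.
pose G : {poly rat} := (-1) ^+ (e * n) *: scale (map_poly intr g).
have GE i : (map_poly ratr G).[u i] =
    (-1) ^+ (e * n) * (map_poly intr g).[(-1) ^+ e * u i].
  rewrite /G map_polyZ hornerZ scaleE -map_poly_intr_ratr /=.
  by rewrite rmorphXn rmorphN1.
have := @edge_prod_gap _ f g G ((-1) ^+ e) `|x - (-1) ^+ e * y| m n u v
  (fun _ _ => true) [set (i0, j0)] n m f0 g0 fE gE.
rewrite cards1 expr1; apply => //.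
- exact: integral_sign.
- by rewrite normr_sign.
- by move=> i; rewrite -[X in (_ <= X)%N]card_ord max_card.
- by move=> i; rewrite -[X in (_ <= X)%N]card_ord max_card.
- move=> i; rewrite GE {1}gE hornerZ mulrCA horner_prod; congr (_ * _).
  rewrite exprM -[X in _ ^+ X]card_ord -prodr_const -big_split /=.
  by apply: eq_bigr => j _; rewrite hornerXsubC mulrBr signrMK.
- by move=> i; rewrite GE mulf_neq0 ?signr_eq0.
- by move=> p; rewrite inE => /eqP ->; rewrite xE yE.
Qed.

(** * Separation of the roots of a reducible polynomial *)

Lemma reducible_minimal_at_size (C : numClosedFieldType) (P f : {poly int})
    (x : C) (d : nat) :
  size P = d.+1 -> reducible_over_Q P -> root (map_poly intr P) x ->
  minimal_at f x -> (size f <= d)%N.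
Proof.
move=> sP [A [B [sA sB PAB]]] Px [f0 _ fmin].
have A0 : A != 0 by rewrite -size_poly_gt0 (ltn_trans _ sA).
have B0 : B != 0 by rewrite -size_poly_gt0 (ltn_trans _ sB).
have sAB : (size A + size B).-1 = d.+1.
  rewrite -size_mul // -PAB size_map_inj_poly //; exact: intr_inj.
have sf : size (map_poly intr f : {poly rat}) = size f.
  by rewrite size_map_inj_poly //; apply: intr_inj.
move: Px; rewrite map_poly_intr_ratr PAB rmorphM rootM.
move=> /orP[/fmin/(dvdp_leq A0)|/fmin/(dvdp_leq B0)]; rewrite sf => sfle;
  move: sAB sA sB sfle; move: (size A) (size B) (size f) => *; lia.
Qed.

Lemma ler_sqr_mulr (K : numDomainType) (A B : K) :
  0 <= A -> 1 <= B -> A ^+ 2 <= (A * B) ^+ 2.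
Proof.
move=> A0 B1; apply: lerXn2r; rewrite ?nnegrE ?ler_peMr //.
by rewrite mulr_ge0 // (le_trans ler01).
Qed.

(** Here D is the square of the distance, A the Mahler measure of f, and W
    bounds the square of the Mahler measure of P. *)
Lemma same_poly_estimate (K : numFieldType) (m d : nat) (D A W : K) :
  (m < d)%N -> 0 <= D -> 1 <= A -> A ^+ 2 <= W ->
  1 <= D * ((2 ^ (m * m.-1))%:R * A ^+ m.-1 * A ^+ m.-1) ->
  1 <= D * ((2 ^ (d * d.-2))%:R * W ^+ d.-2).
Proof.
move=> md D0 A1 AW /le_trans; apply; apply: ler_wpM2l => //.
have A0 : 0 <= A := le_trans ler01 A1.
have W1 : 1 <= W by apply: le_trans AW; rewrite exprn_ege1.
rewrite -mulrA -exprMn -expr2; apply: ler_pM; rewrite ?exprn_ge0 //.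
  by rewrite ler_nat leq_exp2l //; apply: leq_mul; lia.
apply: (@le_trans _ _ (W ^+ m.-1)).
  by rewrite lerXn2r ?nnegrE ?exprn_ge0 // (le_trans ler01).
by apply: ler_weXn2l => //; lia.
Qed.

(** Here D is the distance, and A and B are the Mahler measures of f and g.
    The exponents n and m of A and B are at most d - 2 because m, n >= 2. *)
Lemma coprime_estimate (K : numFieldType) (m n d : nat) (D A B W : K) :
  (1 < m)%N -> (1 < n)%N -> (m + n <= d)%N ->
  0 <= D -> 1 <= A -> 1 <= B -> (A * B) ^+ 2 <= W ->
  1 <= D * ((2 ^ (m * n))%:R * A ^+ n * B ^+ m) ->
  1 <= D ^+ 2 * ((2 ^ (d * d.-2))%:R * W ^+ d.-2).
Proof.
move=> m1 n1 mnd D0 A1 B1 ABW H.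
have A0 : 0 <= A := le_trans ler01 A1.
have B0 : 0 <= B := le_trans ler01 B1.
have /le_trans : 1 <= (D * ((2 ^ (m * n))%:R * A ^+ n * B ^+ m)) ^+ 2.
  by rewrite exprn_ege1.
apply; rewrite exprMn; apply: ler_wpM2l; first by rewrite exprn_ge0.
rewrite -mulrA exprMn -natrX -expnM.
apply: ler_pM; rewrite ?exprn_ge0 ?mulr_ge0 ?exprn_ge0 //.
  (* 2 m n <= (m + n)(m + n - 2), as m^2 - 2 m and n^2 - 2 n are nonnegative. *)
  rewrite ler_nat leq_exp2l //.
  have [k ->] : exists k, d = (m + n + k)%N by exists (d - (m + n))%N; lia.
  case: m m1 {mnd H} => [|[|m]] // _; case: n n1 => [|[|n]] // _.
  rewrite !addSn !addnS !addSn /=; nia.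
apply: (@le_trans _ _ (((A * B) ^+ 2) ^+ d.-2)); last first.
  rewrite lerXn2r ?nnegrE ?exprn_ge0 ?mulr_ge0 //.
  by rewrite (le_trans _ ABW) ?exprn_ge0 ?mulr_ge0.
rewrite exprAC lerXn2r ?nnegrE ?mulr_ge0 ?exprn_ge0 ?mulr_ge0 //.
rewrite exprMn; apply: ler_pM; rewrite ?exprn_ge0 //.
  by apply: ler_weXn2l => //; lia.
by apply: ler_weXn2l => //; lia.
Qed.

(** The case analysis on which of z y and y are roots of the minimal
    polynomial f of x, where z = (-1)^e. *)
Lemma root_separation (C : numClosedFieldType) (P : {poly int}) (d : nat)
    (x y : C) (e : bool) :
  size P = d.+1 -> reducible_over_Q P ->
  root (map_poly intr P) x -> root (map_poly intr P) y ->
  (forall q : rat, x != ratr q) -> (forall q : rat, y != ratr q) ->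
  x ^+ 2 != y ^+ 2 ->
  1 <= `|x - (-1) ^+ e * y| ^+ 2
       * ((2 ^ (d * d.-2))%:R * (d.+1%:R * (height P)%:R ^+ 2) ^+ d.-2).
Proof.
move=> sP redP Px Py xirr yirr xy2.
have P0 : P != 0 by rewrite -size_poly_gt0 sP.
have [f [r [PE fmin]]] := minimal_at_root P0 Px.
have [f0 fx _] := fmin.
have sf2 := minimal_at_size xirr fmin.
have sfd := reducible_minimal_at_size sP redP Px fmin.
have r0 : r != 0 by apply: contraNneq P0 => r0; rewrite PE r0 mulr0.
have map0 (p : {poly int}) : p != 0 -> map_poly intr p != 0 :> {poly C}.
  by move=> p0; rewrite map_poly_eq0_id0 ?intr_eq0 ?lead_coef_eq0.
set W := d.+1%:R * _.
have MPW : mahler (map_poly intr P : {poly C}) ^+ 2 <= W.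
  by rewrite /W -sP; apply: mahler_sq_le_height.
have Mf1 := mahler_ge1 C f0; have Mr1 := mahler_ge1 C r0.
have Mf0 := le_trans ler01 Mf1.
have MfW : mahler (map_poly intr f : {poly C}) ^+ 2 <= W.
  by apply: le_trans MPW; rewrite PE rmorphM mahlerM ?map0 // ler_sqr_mulr.
have md : ((size f).-1 < d)%N by case: (size f) sf2 sfd.
have D0 : 0 <= `|x - (-1) ^+ e * y| ^+ 2 by rewrite exprn_ge0.
have [fey|fNey] := boolP (root (map_poly intr f) ((-1) ^+ e * y)).
  apply: same_poly_estimate md D0 Mf1 MfW _.
  apply: conjugates_bound => //; apply: contraNneq xy2 => ->.
  by rewrite exprMn sqrr_sign mul1r.
have [fy|fNy] := boolP (root (map_poly intr f) y).
  apply: same_poly_estimate md D0 Mf1 MfW _.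
  case: e fNey => [|]; last by rewrite expr0 mul1r fy.
  rewrite expr1 mulN1r opprK => fNy; apply: sum_conjugates_bound => //.
  by apply: contraNneq xy2 => ->.
have ry : root (map_poly intr r) y.
  by move: Py; rewrite PE rmorphM rootM (negPf fNy).
have [g [s [rE gmin]]] := minimal_at_root r0 ry.
have [g0 _ _] := gmin.
have sg2 := minimal_at_size yirr gmin.
have s0 : s != 0 by apply: contraNneq r0 => s0; rewrite rE s0 mulr0.
have Mg1 := mahler_ge1 C g0; have Ms1 := mahler_ge1 C s0.
have Mg0 := le_trans ler01 Mg1.
apply: coprime_estimate Mf1 Mg1 _ (coprime_bound fmin gmin fNey) => //.
- by case: (size f) sf2.
- by case: (size g) sg2.
- have ss : (0 < size s)%N by rewrite size_poly_gt0.
  move: sP; rewrite PE rE !size_mul ?mulf_neq0 //.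
  by move: (size f) (size g) (size s) sf2 sg2 ss => ? ? ?; clear; lia.
- apply: le_trans MPW; rewrite PE rE !rmorphM !mahlerM ?mulf_neq0 ?map0 //.
  by rewrite mulrA ler_sqr_mulr // (mulr_ge0 Mf0 Mg0).
Qed.

Lemma real_root_separation (R : rcfType) (P : {poly int}) (d : nat)
    (x y : R) :
  size P = d.+1 -> reducible_over_Q P ->
  root (map_poly intr P) x -> root (map_poly intr P) y ->
  (forall q : rat, x != ratr q) -> (forall q : rat, y != ratr q) ->
  `|x| != `|y| ->
  1 <= (`|x| - `|y|) ^+ 2
       * ((2 ^ (d * d.-2))%:R * (d.+1%:R * (height P)%:R ^+ 2) ^+ d.-2).
Proof.
move=> sP redP Px Py xirr yirr xy.
pose toC : {rmorphism R -> R[i]} := real_complex R.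
have rootC z : root (map_poly intr P) z -> root (map_poly intr P) (toC z).
  have -> : map_poly intr P = map_poly toC (map_poly intr P) :> {poly R[i]}.
    by rewrite -map_poly_comp; apply: eq_map_poly => k /=; rewrite rmorph_int.
  by rewrite fmorph_root.
have irrC z : (forall q : rat, z != ratr q) -> forall q : rat, toC z != ratr q.
  move=> zirr q; have -> : ratr q = toC (ratr q) by rewrite fmorph_rat.
  by rewrite (inj_eq (fmorph_inj _)).
have xy2 : toC x ^+ 2 != toC y ^+ 2.
  rewrite -!rmorphXn (inj_eq (fmorph_inj _)) /=.
  by rewrite -(real_normK (num_real x)) -(real_normK (num_real y)) eqrXn2.
have [e xyE] : exists e : bool, (`|x| - `|y|) ^+ 2 = (x - (-1) ^+ e * y) ^+ 2.
  (* The sign is the product of the signs of x and y. *)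
  have [Ex Ey] := (numEsign x, numEsign y).
  exists ((x < 0) (+) (y < 0)); move: (x < 0) (y < 0) Ex Ey => a b -> ->.
  rewrite !normrM !normr_sign !mul1r !normr_id mulrA -signr_addb addbK -mulrBr.
  by rewrite exprMn sqrr_sign mul1r.
have := root_separation e sP redP (rootC _ Px) (rootC _ Py)
  (irrC _ xirr) (irrC _ yirr) xy2.
have -> : `|toC x - (-1) ^+ e * toC y| ^+ 2 = toC ((`|x| - `|y|) ^+ 2).
  rewrite xyE; have -> : toC x - (-1) ^+ e * toC y = toC (x - (-1) ^+ e * y).
    by rewrite rmorphB rmorphM rmorph_sign.
  by rewrite sqr_normc [(toC _)^*%C]conjc_real -expr2 rmorphXn.
have -> : (1 : R[i]) = toC 1 by rewrite rmorph1.
by rewrite -(rmorph_nat toC) -(rmorph_nat toC d.+1) -(rmorph_nat toC (height P))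
  -!(rmorphXn, rmorphM) lecR.
Qed.

(** * The explicit constant *)

(** Uses d + 1 <= 2 d; the right-hand side is the inverse square of the
    required lower bound. *)
Lemma separation_constant_le (d H : nat) : (1 < d)%N ->
  (2 ^ (d * d.-2) * (d.+1 * H ^ 2) ^ d.-2
   <= 2 ^ (3 * d ^ 2 + 2 - 6 * d) * d ^ d.-2 * (H ^ d.-2) ^ 2)%N.
Proof.
move=> d1; rewrite expnMn expnAC mulnA leq_mul2r; apply/orP; right.
apply: (@leq_trans (2 ^ (d * d.-2) * (2 * d) ^ d.-2)%N).
  rewrite leq_mul2l; apply/orP; right.
  by case: d.-2 => [|k] //; rewrite leq_exp2r //; lia.
rewrite expnMn mulnA leq_mul2r -expnD; apply/orP; right.
rewrite leq_exp2l //; case: d d1 => [|[|k]] // _; rewrite /= -mulnn; nia.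
Qed.

Lemma powR_sqr_inv (R : realType) (a : R) (r : R) (n : nat) :
  0 <= a -> r * 2 = - n%:R -> (a `^ r) ^+ 2 = (a ^+ n)^-1.
Proof.
move=> a0 rE; rewrite -powR_mulrn ?powR_ge0 // -powRrM rE powRN.
by rewrite powR_mulrn.
Qed.

Theorem theorem2 (R : realType) (P : {poly int}) (d : nat)
    (degP : size P = d.+1) (redP : reducible_over_Q P)
    (alpha beta : R)
    (rootPalpha : root (map_poly intr P) alpha)
    (rootPbeta : root (map_poly intr P) beta)
    (irr_alpha : irrational alpha) (irr_beta : irrational beta) :
  `|alpha| = `|beta| \/
  (2 : R) `^ (- (3 * d%:R ^+ 2 / 2) + 3 * d%:R - 1)
    * d%:R `^ ((- d%:R + 2) / 2)
    * (height P)%:R `^ (- d%:R + 2)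
  <= `| `|alpha| - `|beta| |.
Proof.
have [ab|ab] := eqVneq `|alpha| `|beta|; [by left|right].
have not_rat (z : R) : irrational z -> forall q : rat, z != ratr q.
  by move=> zirr q; apply/eqP => zq; apply: zirr; exists q.
have d1 : (1 < d)%N.
  have [A [B [sA sB PAB]]] := redP.
  have A0 : A != 0 by rewrite -size_poly_gt0 (ltn_trans _ sA).
  have B0 : B != 0 by rewrite -size_poly_gt0 (ltn_trans _ sB).
  have : (size A + size B).-1 = d.+1.
    by rewrite -size_mul // -PAB size_map_inj_poly //; apply: intr_inj.
  by move: (size A) (size B) sA sB => ? ?; clear; lia.
have sep := real_root_separation degP redP rootPalpha rootPbeta
  (not_rat _ irr_alpha) (not_rat _ irr_beta) ab.
have H0 : (0 < height P)%N.
  have dP : (d < size P)%N by rewrite degP.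
  apply: leq_trans (leq_bigmax (Ordinal dP)); rewrite absz_gt0 /=.
  by rewrite -[d]/(d.+1.-1) -degP -lead_coefE lead_coef_eq0 -size_poly_gt0 degP.
set X := (2 ^ (d * d.-2) * (d.+1 * height P ^ 2) ^ d.-2)%N.
set N := (2 ^ (3 * d ^ 2 + 2 - 6 * d) * d ^ d.-2 * (height P ^ d.-2) ^ 2)%N.
have XN : (X <= N)%N by apply: separation_constant_le.
have N0 : 0 < N%:R :> R by rewrite ltr0n !muln_gt0 !expn_gt0 H0 (ltnW d1).
have dE : d%:R = d.-2%:R + 2 :> R by rewrite -natrD; congr _%:R; lia.
set B := _ * _.
have BE : B ^+ 2 = N%:R^-1.
  rewrite /B /N 2!natrM !natrX 2!invfM 2!exprMn; congr (_ * _ * _).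
  - apply: powR_sqr_inv => //; rewrite natrB; last by nia.
    by rewrite natrD !natrM expr2; field.
  - by apply: powR_sqr_inv => //; rewrite dE; field.
  - rewrite -exprVn; congr (_ ^+ 2).
    have -> : - d%:R + 2 = - d.-2%:R :> R by rewrite dE; ring.
    by rewrite powRN powR_mulrn.
(* Squaring removes the half-integral exponents of 2 and d. *)
rewrite -ler_sqr ?nnegrE ?mulr_ge0 ?powR_ge0 // -/B BE real_normK ?num_real //.
rewrite -[X in X <= _]mul1r ler_pdivrMr //.
apply: le_trans sep _; rewrite -!natrX -!natrM -natrX -natrM.
by apply: ler_wpM2l; rewrite ?sqr_ge0 // ler_nat.
Qed.
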